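(* Let $K$ be an augmented directed complex with a loop-free unital basis $P$, regarded also as its associated $\omega$-hypergraph. Then the function $\Sigma$ induces an isomorphism of $\omega$-categories between $\mathrm{Cell}(P)$ and $\mathrm{Cell}(K)$. Moreover, $\Sigma(\langle x\rangle)=[x]$ for every $x\in P$.
   Context: Augmented directed complexes: an augmented directed complex (adc) $K$ consists of abelian groups $K_n$ with distinguished submonoids $K_n^*\subseteq K_n$ ($n\in\mathbb{N}$), group morphisms $d_n\colon K_{n+1}\to K_n$ and $e\colon K_0\to\mathbb{Z}$ with $e\circ d_0=0$ and $d_n\circ d_{n+1}=0$. A basis of $K$ is a graded set $P=\bigsqcup_nP_n$ with $P_n\subseteq K_n$ such that each $K^*_n$ is the free commutative monoid on $P_n$ and each $K_n$ is the free abelian group on $P_n$. Given a basis, $u\in K_n$ is written $u=\sum_{g\in P_n}u_gg$; $u\le v$ means $u_g\le v_g$ for all $g$; $u\wedge v=\sum_g\min(u_g,v_g)g$. For $u\in K_{n+1}$, $d^-u,d^+u\in K_n^*$ are the unique elements with $d_nu=d^+u-d^-u$ and $d^-u\wedge d^+u=0$. For $x\in P_n$, the atom $[x]$ is the tuple with $[x]_{n}=[x]_{n,-}=[x]_{n,+}=x$ and, for $j<n$, $[x]_{j,-}=d^-([x]_{j+1,-})$, $[x]_{j,+}=d^+([x]_{j+1,+})$. For $i\in\mathbb{N}$, $<_i$ is the smallest transitive relation on $P$ such that $u<_iv$ whenever $u\in P_k$, $v\in P_l$, $i<\min(k,l)$ and $[u]_{i,+}\wedge[v]_{i,-}\ne0$.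 The basis is unital if $e([x]_{0,-})=e([x]_{0,+})=1$ for all $x\in P$, and loop-free if every $<_i$ is irreflexive. An $n$-pre-cell of $K$ is a tuple $X=(X_{0,-},X_{0,+},\ldots,X_{n-1,-},X_{n-1,+},X_n)$ with $X_{i,\epsilon}\in K_i^*$, $X_n\in K_n^*$, with $X_{n,-}=X_{n,+}=X_n$ and $\partial^\epsilon_iX=(X_{0,-},\ldots,X_{i-1,+},X_{i,\epsilon})$; it is an $n$-cell if $d_i(X_{i+1,-})=d_i(X_{i+1,+})=X_{i,+}-X_{i,-}$ for $0\le i<n$ and $e(X_{0,-})=e(X_{0,+})=1$. $\mathrm{Cell}(K)$ is the graded set of cells of $K$, with identities $X\mapsto(X_{0,-},\ldots,X_{n-1,+},X_n,X_n,0)$ and composition, for $\partial^+_iX=\partial^-_iY$, $X\ast_iY=Z$ with $Z_{j,\epsilon}=X_{j,\epsilon}$ for $j<i$, $Z_{i,-}=X_{i,-}$, $Z_{i,+}=Y_{i,+}$, $Z_{j,\epsilon}=X_{j,\epsilon}+Y_{j,\epsilon}$ for $j>i$. An $\omega$-hypergraph is a set $P=\bigsqcup_{n}P_n$ together with, for $u\in P_{n+1}$, finite subsets $u^-,u^+\subseteq P_n$. The $\omega$-hypergraph associated to $K$ is the graded set $P$ with $x^\epsilon=\{y\in P_n\mid y\le d^\epsilon x\}$ for $x\in P_{n+1}$, $\epsilon\in\{-,+\}$. For $U\subseteq P$, $U^\epsilon=\bigcup_{u\in U}u^\epsilon$, $U^\mp=U^-\setminus U^+$, $U^\pm=U^+\setminus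 U^-$. $U\subseteq P_n$ is fork-free if either $n=0$ and $|U|=1$, or $n>0$ and $u^\epsilon\cap v^\epsilon=\emptyset$ for all distinct $u,v\in U$ and all $\epsilon$. An $n$-pre-cell of $P$ is a tuple $X=(X_{0,-},X_{0,+},\ldots,X_{n-1,-},X_{n-1,+},X_n)$ of finite subsets $X_{i,\epsilon}\subseteq P_i$, $X_n\subseteq P_n$, with $X_{n,-}=X_{n,+}=X_n$ and $\partial^\epsilon_iX=(X_{0,-},\ldots,X_{i-1,+},X_{i,\epsilon})$. A finite set $M\subseteq P_{i+1}$ moves $U$ to $V$ (finite subsets of $P_i$) if $U=(V\cup M^-)\setminus M^+$ and $V=(U\cup M^+)\setminus M^-$. An $n$-cell of $P$ is an $n$-pre-cell such that $X_{i+1,\epsilon}$ moves $X_{i,-}$ to $X_{i,+}$ for $0\le i<n$ and every $X_{i,\epsilon}$ is fork-free. $\mathrm{Cell}(P)$ is the graded set of cells of $P$, with identities $X\mapsto(X_{0,-},\ldots,X_{n-1,+},X_n,X_n,\emptyset)$ and composition, for $\partial^+_iX=\partial^-_iY$, $X\ast_iY=Z$ with $Z_{j,\epsilon}=X_{j,\epsilon}$ for $j<i$, $Z_{i,-}=X_{i,-}$, $Z_{i,+}=Y_{i,+}$, $Z_{j,\epsilon}=X_{j,\epsilon}\cup Y_{j,\epsilon}$ for $j>i$. For $x\in P_n$, $\langle x\rangle$ is the $n$-pre-cell with $\langle x\rangle_n=\{x\}$ and, for $j<n$, $\langle x\rangle_{j,-}=(\langle x\rangle_{j+1,-})^\mp$,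 $\langle x\rangle_{j,+}=(\langle x\rangle_{j+1,+})^\pm$. Both $\mathrm{Cell}(K)$ and $\mathrm{Cell}(P)$ are strict $\omega$-categories. $\Sigma$ maps an $n$-pre-cell $X$ of $P$ to the $n$-pre-cell of $K$ with $\Sigma(X)_{i,\epsilon}=\sum_{x\in X_{i,\epsilon}}x$ for $0\le i\le n$ and $\epsilon\in\{-,+\}$. *)

(* Defs.v *)
From HB Require Import structures.
From Stdlib Require Import Relations.
From mathcomp Require Import all_boot all_order all_algebra.
From mathcomp Require Import finmap.
From mathcomp Require Import all_classical.

Set Implicit Arguments.
Unset Strict Implicit.
Unset Printing Implicit Defensive.

Import Order.TTheory GRing.Theory Num.Theory.

Local Open Scope classical_set_scope.
Local Open Scope ring_scope.

(* Throughout, a sign is a boolean: [false] stands for - and [true] for +. *)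

(** * Strict omega-categories *)

(* The operations are given on an ambient graded family [oamb] (below: the
   pre-cells); the actual n-cells are the elements of the subset [ocell n].
   [ocomp n i h x y] is only meaningful when x and y are n-cells with
   obd h true x = obd h false y. *)
Record omega_data := OmegaData {
  oamb : nat -> Type;
  ocell : forall n, set (oamb n);
  obd : forall n i, (i < n)%N -> bool -> oamb n -> oamb i;
  oid : forall n, oamb n -> oamb n.+1;
  ocomp : forall n i, (i < n)%N -> oamb n -> oamb n -> oamb n }.

Section OmegaCategories.

Definition ocomposable (C : omega_data) n i (h : (i < n)%N) (x y : oamb C n) :=
  obd h true x = obd h false y.

Fixpoint oidn (C : omega_data) i k (x : oamb C i) : oamb C (k + i) :=
  if k is k'.+1 then oid (oidn k' x) else x.

Record is_omega_category (C : omega_data) : Prop := IsOmegaCategory {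
  obd_cell : forall n i (h : (i < n)%N) e (x : oamb C n),
    ocell x -> ocell (obd h e x);
  oid_cell : forall n (x : oamb C n), ocell x -> ocell (oid x);
  ocomp_cell : forall n i (h : (i < n)%N) (x y : oamb C n),
    ocell x -> ocell y -> ocomposable h x y -> ocell (ocomp h x y);
  obd_obd : forall n j i (hj : (j < n)%N) (hi : (i < j)%N) (h : (i < n)%N)
      e e' (x : oamb C n),
    ocell x -> obd hi e (obd hj e' x) = obd h e x;
  obd_oid : forall n e (x : oamb C n),
    ocell x -> obd (ltnSn n) e (oid x) = x;
  obd_ocomp_src : forall n i (h : (i < n)%N) (x y : oamb C n),
    ocell x -> ocell y -> ocomposable h x y ->
    obd h false (ocomp h x y) = obd h false x;
  obd_ocomp_tgt : forall n i (h : (i < n)%N) (x y : oamb C n),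
    ocell x -> ocell y -> ocomposable h x y ->
    obd h true (ocomp h x y) = obd h true y;
  obd_ocomp : forall n j i (hj : (j < n)%N) (hi : (i < j)%N) (h : (i < n)%N)
      e (x y : oamb C n),
    ocell x -> ocell y -> ocomposable h x y ->
    obd hj e (ocomp h x y) = ocomp hi (obd hj e x) (obd hj e y);
  ocompA : forall n i (h : (i < n)%N) (x y z : oamb C n),
    ocell x -> ocell y -> ocell z -> ocomposable h x y -> ocomposable h y z ->
    ocomp h (ocomp h x y) z = ocomp h x (ocomp h y z);
  ocomp_idl : forall i k (h : (i < k.+1 + i)%N) (x : oamb C (k.+1 + i)),
    ocell x -> ocomp h (oidn k.+1 (obd h false x)) x = x;
  ocomp_idr : forall i k (h : (i < k.+1 + i)%N) (x : oamb C (k.+1 + i)),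
    ocell x -> ocomp h x (oidn k.+1 (obd h true x)) = x;
  ocomp_exchange : forall n j i (hj : (j < n)%N) (hi : (i < n)%N)
      (x x' y y' : oamb C n),
    (i < j)%N -> ocell x -> ocell x' -> ocell y -> ocell y' ->
    ocomposable hj x x' -> ocomposable hj y y' ->
    ocomposable hi x y -> ocomposable hi x' y' ->
    ocomp hi (ocomp hj x x') (ocomp hj y y')
    = ocomp hj (ocomp hi x y) (ocomp hi x' y');
  oid_ocomp : forall n i (h : (i < n)%N) (h' : (i < n.+1)%N) (x y : oamb C n),
    ocell x -> ocell y -> ocomposable h x y ->
    oid (ocomp h x y) = ocomp h' (oid x) (oid y) }.

Record is_omega_functor (C D : omega_data) (F : forall n, oamb C n -> oamb D n)
    : Prop := IsOmegaFunctor {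
  ofun_cell : forall n (x : oamb C n), ocell x -> ocell (F n x);
  ofun_bd : forall n i (h : (i < n)%N) e (x : oamb C n),
    ocell x -> F i (obd h e x) = obd h e (F n x);
  ofun_id : forall n (x : oamb C n), ocell x -> F n.+1 (oid x) = oid (F n x);
  ofun_comp : forall n i (h : (i < n)%N) (x y : oamb C n),
    ocell x -> ocell y -> ocomposable h x y ->
    F n (ocomp h x y) = ocomp h (F n x) (F n y) }.

(* [F] induces an isomorphism of strict omega-categories; what it does to
   elements of the ambient family which are not cells is irrelevant. *)
Definition is_omega_isomorphism (C D : omega_data)
    (F : forall n, oamb C n -> oamb D n) : Prop :=
  [/\ is_omega_category C, is_omega_category D, is_omega_functor F &
      exists G : forall n, oamb D n -> oamb C n,
        [/\ is_omega_functor G,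
            forall n (x : oamb C n), ocell x -> G n (F n x) = x &
            forall n (y : oamb D n), ocell y -> F n (G n y) = y]].

End OmegaCategories.

(** * Pre-cells over a graded family of types *)

(* The tuple (X_{0,-}, X_{0,+}, ..., X_{n-1,-}, X_{n-1,+}, X_n). *)
Record precell (A : nat -> Type) (n : nat) := Precell {
  low : forall i, (i < n)%N -> bool -> A i;
  top : A n }.

Lemma leq_cases i n : (i <= n)%N -> {(i < n)%N} + {n = i}.
Proof.
by move=> h; case: (ltnP i n) => [|h']; [left | right; apply/anti_leq/andP].
Defined.

Section Precells.
Variable A : nat -> Type.

(* X_{i,e} for i <= n, with X_{n,-} = X_{n,+} = X_n. *)
Definition face n (X : precell A n) i (h : (i <= n)%N) (e : bool) : A i :=
  match leq_cases h with
  | left h' => low X h' e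
  | right E => ecast k (A k) E (top X)
  end.

Lemma face_low n (X : precell A n) i (h : (i <= n)%N) (h' : (i < n)%N) e :
  face X h e = low X h' e.
Proof.
rewrite /face; case: leq_cases => [h''|E].
  by rewrite (bool_irrelevance h'' h').
by exfalso; rewrite E ltnn in h'.
Qed.

Lemma face_top n (X : precell A n) (h : (n <= n)%N) e : face X h e = top X.
Proof.
rewrite /face; case: leq_cases => [h'|E]; first by exfalso; rewrite ltnn in h'.
by rewrite (eq_irrelevance E erefl).
Qed.

Definition pbd n i (h : (i < n)%N) (e : bool) (X : precell A n) : precell A i :=
  Precell (fun j (hj : (j < i)%N) e' => low X (ltn_trans hj h) e') (low X h e).

Definition pid (z : forall n, A n) n (X : precell A n) : precell A n.+1 :=
  Precell (fun j (hj : (j < n.+1)%N) e => face X hj e) (z n.+1).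

Definition pcomp (op : forall n, A n -> A n -> A n) n i (h : (i < n)%N)
    (X Y : precell A n) : precell A n :=
  Precell
    (fun j (hj : (j < n)%N) e =>
       if (j < i)%N then low X hj e
       else if j == i then (if e then low Y hj true else low X hj false)
       else op j (low X hj e) (low Y hj e))
    (op n (top X) (top Y)).

(* The pre-cell X with X_n = x and X_{j,e} = f e X_{j+1,e} for j < n (see
   [face_descent]): its faces of sign e in dimensions < n are those of the
   pre-cell obtained from f e x. *)
Fixpoint descent (f : bool -> forall n, A n.+1 -> A n) n : A n -> precell A n :=
  match n with
  | 0 => fun x => Precell (fun j (h : (j < 0)%N) _ => False_rect _ (notF h)) x
  | m.+1 => fun x =>
      Precell (fun j (h : (j < m.+1)%N) e => face (descent f (f e m x)) h e) x
  end.

Lemma face_descent f n (x : A n) :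
  top (descent f x) = x /\
  forall j (h : (j < n)%N) e,
    low (descent f x) h e = f e j (face (descent f x) h e).
Proof.
split; first by case: n x.
elim: n x => [|n IH] x j h e //=.
have [hj|jn] := leq_cases (h : (j <= n)%N).
  by rewrite (face_low _ _ hj) IH (face_low (n := n.+1) _ _ (hj : (j.+1 < n.+1)%N)).
subst j; rewrite face_top (face_top (n := n.+1)) /=.
by case: n {IH h} x.
Qed.

End Precells.

(** * Augmented directed complexes *)

Record adc := Adc {
  adc_grp :> nat -> zmodType;
  adc_pos : forall n, set (adc_grp n);
  adc_d : forall n, {additive adc_grp n.+1 -> adc_grp n};
  adc_e : {additive adc_grp 0 -> int};
  adc_pos0 : forall n, @adc_pos n 0;
  adc_posD : forall n (u v : adc_grp n),
    adc_pos u -> adc_pos v -> adc_pos (u + v);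
  adc_ed : forall u, adc_e (adc_d 0 u) = 0;
  adc_dd : forall n u, adc_d n (adc_d n.+1 u) = 0 }.

Section AdcBasis.
Variables (K : adc) (P : forall n, set (K n)).
Arguments P : clear implicits.

Definition zcomb n (c : {fsfun P n -> int with 0}) : K n :=
  \sum_(g <- finsupp c) val g *~ c g.

Definition ncomb n (c : {fsfun P n -> nat with 0%N}) : K n :=
  \sum_(g <- finsupp c) val g *+ c g.

(* The free commutative monoid (resp. abelian group) on a set is realised by
   its finitely supported functions to nat (resp. int). *)
Definition is_basis : Prop :=
  forall n, set_bij setT (@adc_pos K n) (@ncomb n) /\
            set_bij setT [set: K n] (@zcomb n).

(* The family of the coefficients u_g. *)
Definition coef n (u : K n) : {fsfun P n -> int with 0} :=
  xget [fsfun with 0] [set c | zcomb c = u].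

Definition kle n (u v : K n) : Prop := forall g, coef u g <= coef v g.

Definition kmeet n (u v : K n) : K n :=
  \sum_(g <- (finsupp (coef u) `|` finsupp (coef v))%fset)
    val g *~ Num.min (coef u g) (coef v g).

(* The pair (d^- u, d^+ u). *)
Definition dpair n (u : K n.+1) : K n * K n :=
  xget (0, 0) [set p | [/\ adc_pos p.1, adc_pos p.2,
                           adc_d K n u = p.2 - p.1 & kmeet p.1 p.2 = 0]].

Definition dsign (e : bool) n (u : K n.+1) : K n :=
  if e then (dpair u).2 else (dpair u).1.

Definition atom n (x : K n) : precell (fun i => K i) n := descent (A := fun i => K i) dsign x.

Definition unital : Prop :=
  forall n (x : P n) e, adc_e K (face (atom (val x)) (leq0n n) e) = 1.

(* The generating pairs of the relation <_i on the disjoint union of the P_n. *)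
Definition prec_gen i (u v : {n : nat & P n}) : Prop :=
  exists (hu : (i < projT1 u)%N) (hv : (i < projT1 v)%N),
    kmeet (low (atom (val (projT2 u))) hu true)
          (low (atom (val (projT2 v))) hv false) <> 0.

Definition prec i : relation {n : nat & P n} := clos_trans _ (prec_gen i).

Definition loop_free : Prop := forall i u, ~ prec i u u.

End AdcBasis.

Definition is_cellK (K : adc) n (X : precell (fun i => K i) n) : Prop :=
  [/\ forall i (h : (i <= n)%N) e, adc_pos (face X h e),
      forall i (h : (i < n)%N) e,
        adc_d K i (face X (h : (i.+1 <= n)%N) e) = low X h true - low X h false &
      forall e, adc_e K (face X (leq0n n) e) = 1].

Definition CellK (K : adc) : omega_data := {|
  oamb := precell (fun i => K i);
  ocell := @is_cellK K;
  obd := @pbd (fun i => K i);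
  oid := pid (fun n => 0 : K n);
  ocomp := pcomp (fun n (u v : K n) => u + v) |}.

(** * Omega-hypergraphs *)

(* [hg_face false u] is u^- and [hg_face true u] is u^+. *)
Record hypergraph := Hypergraph {
  hg_sort :> nat -> choiceType;
  hg_face : bool -> forall n, hg_sort n.+1 -> {fset hg_sort n} }.

Section Hypergraph.
Variable P : hypergraph.
Local Open Scope fset_scope.

Local Notation F n := {fset P n}.

Definition fface (e : bool) n (U : F n.+1) : F n :=
  \bigcup_(u <- U) hg_face e u.

Definition fork_free n : F n -> Prop :=
  match n with
  | 0 => fun U => #|` U| = 1%N
  | m.+1 => fun U => forall e (u v : P m.+1), u \in U -> v \in U -> u <> v ->
      hg_face e u `&` hg_face e v = fset0
  end.

Definition moves n (M : F n.+1) (U V : F n) : Prop :=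
  U = (V `|` fface false M) `\` fface true M /\
  V = (U `|` fface true M) `\` fface false M.

Definition is_cellP n (X : precell (fun i => F i) n) : Prop :=
  (forall i (h : (i < n)%N) e,
     moves (face X (h : (i.+1 <= n)%N) e) (low X h false) (low X h true)) /\
  (forall i (h : (i <= n)%N) e, fork_free (face X h e)).

Definition CellP : omega_data := {|
  oamb := precell (fun i => F i);
  ocell := is_cellP;
  obd := @pbd (fun i => F i);
  oid := pid (fun n => fset0 : F n);
  ocomp := pcomp (fun n (U V : F n) => U `|` V) |}.

(* U^{-+} = U^- \ U^+ for e = false and U^{+-} = U^+ \ U^- for e = true. *)
Definition fborder (e : bool) n (U : F n.+1) : F n :=
  fface e U `\` fface (~~ e) U.

(* <x> *)
Definition hatom n (x : P n) : precell (fun i => F i) n :=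
  descent fborder [fset x].

End Hypergraph.

(* The set defining x^e is finite when P is a basis, so that [fset_set] does
   not fall back on its default value. *)
Definition hypergraph_of (K : adc) (P : forall n, set (K n)) : hypergraph := {|
  hg_sort := fun n => P n : choiceType;
  hg_face := fun e n (x : P n.+1) =>
    fset_set [set y : P n | kle P (val y) (dsign P e (val x))] |}.

Definition Sigma (K : adc) (P : forall n, set (K n)) n
    (X : oamb (CellP (hypergraph_of P)) n) : oamb (CellK K) n :=
  Precell (fun i (h : (i < n)%N) e => \sum_(x <- low X h e) val x)
          (\sum_(x <- top X) val x).
Arguments Sigma {K} P n X.
Arguments hatom P {n} x.
Arguments is_omega_isomorphism C D F : clear implicits.

(* Main.v *)
Require Import Defs.
From HB Require Import structures.
From Stdlib Require Import Relations.
From mathcomp Require Import all_boot all_order all_algebra.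
From mathcomp Require Import finmap.
From mathcomp Require Import all_classical.

Set Implicit Arguments.
Unset Strict Implicit.
Unset Printing Implicit Defensive.

Import Order.TTheory GRing.Theory Num.Theory.

(* The inverse of Sigma takes supports. All that matters is that, for a cell X
   of K with n-dimensional boundaries U = X_{n,-} and V = X_{n,+} and with
   (n+1)-dimensional part x, the sums U + sum_h x_h d^+h and V + sum_h x_h d^-h
   have all their coefficients at most 1. This goes by induction on n: for a
   set D of generators that is down-closed for <_n, replacing U by
   W = U + d(the part of x in D) gives an n-cell again, so that W has
   coefficients at most 1. Given a generator g, acyclicity of <_n provides a D
   that contains all producers of g and none of its consumers, and then
   W_g = U_g + sum_h x_h (d^+h)_g. It follows that supports of cells of K are
   fork-free and that each one moves U to V, while multiplicity-freeness makes
   the sum over the support give back the cell. The omega-category structure of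
   Cell(P) is transported from Cell(K). *)

(** * Cells labelled by commutative monoids *)

Section Precells.
Variable A : nat -> Type.

Lemma precell_ext n (X Y : precell A n) :
  (forall j (h : j < n) e, low X h e = low Y h e) -> top X = top Y -> X = Y.
Proof.
case: X Y => [lX tX] [lY tY] /= hl ->; congr Precell.
by apply: functional_extensionality_dep => j; apply/funext => h; apply/funext.
Qed.

Lemma low_face n (X : precell A n) i (h : i < n) e :
  low X h e = face X (ltnW h) e.
Proof. by rewrite (face_low _ _ h). Qed.

Lemma face_irrel n (X : precell A n) i (h h' : i <= n) e :
  face X h e = face X h' e.
Proof. by rewrite (bool_irrelevance h h'). Qed.

Lemma face_pbd_lt n i (h : i < n) e (X : precell A n) j (hj : j <= i)
    (hj' : j <= n) e' : j < i -> face (pbd h e X) hj e' = face X hj' e'.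
Proof.
move=> ji; rewrite (face_low _ _ ji) (face_low _ _ (leq_trans ji (ltnW h))) /=.
by congr low; apply: bool_irrelevance.
Qed.

Lemma face_pbd_eq n i (h : i < n) e (X : precell A n) (hj : i <= i)
    (hj' : i <= n) e' : face (pbd h e X) hj e' = face X hj' e.
Proof. by rewrite face_top /= low_face; apply: face_irrel. Qed.

Lemma face_pid_le (z : forall n, A n) n (X : precell A n) j (h : j <= n.+1)
    (h' : j <= n) e : face (pid z X) h e = face X h' e.
Proof. by rewrite (face_low _ _ (h' : j < n.+1)). Qed.

Lemma face_pid_top (z : forall n, A n) n (X : precell A n) (h : n.+1 <= n.+1) e :
  face (pid z X) h e = z n.+1.
Proof. by rewrite face_top. Qed.

Lemma face_pcomp (op : forall n, A n -> A n -> A n) n i (h : i < n)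
    (X Y : precell A n) j (hj : j <= n) e :
  face (Defs.pcomp op h X Y) hj e =
  if j < i then face X hj e
  else if j == i then if e then face Y hj true else face X hj false
  else op j (face X hj e) (face Y hj e).
Proof.
case: (leq_cases hj) => [h'|E]; first by rewrite !(face_low _ _ h').
by subst j; rewrite !face_top /= ltnNge (ltnW h) /= gtn_eqF.
Qed.

Lemma pbd_pbd n j i (hj : j < n) (hi : i < j) (h : i < n) e e'
    (X : precell A n) : pbd hi e (pbd hj e' X) = pbd h e X.
Proof.
by apply: precell_ext => [k hk e''|] /=; congr low; apply: bool_irrelevance.
Qed.

Lemma composable_face n i (h : i < n) (X Y : precell A n) :
  pbd h true X = pbd h false Y ->
  (forall j (hj : j <= n) e, j < i -> face X hj e = face Y hj e) /\
  (forall hi : i <= n, face X hi true = face Y hi false).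
Proof.
move=> E; split=> [j hj e ji|hi].
  by rewrite -(face_pbd_lt h true X (ltnW ji) hj e ji) E (face_pbd_lt _ _ _ _ hj).
by rewrite -(face_pbd_eq h true X (leqnn i) hi true) E (face_pbd_eq _ _ _ _ hi).
Qed.

Section PrecellCategory.
Variables (op : forall n, A n -> A n -> A n) (z : forall n, A n).
Hypotheses (opA : forall n, associative (@op n))
  (opC : forall n, commutative (@op n)) (op0 : forall n, left_id (z n) (@op n)).
Variable cell : forall n, set (precell A n).

Definition precell_data : omega_data := OmegaData cell (@pbd A) (pid z) (Defs.pcomp op).

Hypothesis bd_cell : forall n i (h : i < n) e (X : precell A n),
  cell X -> cell (pbd h e X).
Hypothesis id_cell : forall n (X : precell A n), cell X -> cell (pid z X).
Hypothesis comp_cell : forall n i (h : i < n) (X Y : precell A n),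
  cell X -> cell Y -> pbd h true X = pbd h false Y -> cell (Defs.pcomp op h X Y).

Lemma face_oidn_le i k (X : precell A i) j (h : j <= k + i) (h' : j <= i) e :
  face (oidn (C := precell_data) k X) h e = face X h' e.
Proof.
elim: k h => [|k IH] h; first exact: face_irrel.
have hk : j <= k + i by rewrite (leq_trans h') ?leq_addl.
by rewrite /= (face_pid_le _ _ _ hk) IH.
Qed.

Lemma face_oidn_gt i k (X : precell A i) j (h : j <= k + i) e :
  i < j -> face (oidn (C := precell_data) k X) h e = z j.
Proof.
move=> ij; elim: k h => [|k IH] h; first by have := h; rewrite leqNgt ij.
case: (leq_cases h) => [h'|E].
  by rewrite /= (face_pid_le _ _ _ (h' : j <= k + i)) IH.
by subst j; rewrite face_top.
Qed.

Let op0r n : right_id (z n) (@op n).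
Proof. by move=> x; rewrite opC op0. Qed.

Let opACA n : interchange (@op n) (@op n).
Proof. by move=> a b c d; rewrite !opA -(opA a) (opC b) opA. Qed.

Lemma precell_face_ext n (X Y : precell A n) :
  (forall j (h : j <= n) e, face X h e = face Y h e) -> X = Y.
Proof.
move=> E; apply: precell_ext => [j h e|]; first by rewrite !low_face.
by rewrite -(face_top X (leqnn n) true) E face_top.
Qed.

(** Up to dimension [i] a composite merely selects faces, and above it each axiom is a commutative
    monoid law, exchange being [opACA]. The subset [cell] enters only through closure under the
    operations, so sums and unions are both covered. *)
Lemma precell_omega_category : is_omega_category precell_data.
Proof.
split=> //=.
- by move=> *; apply: pbd_pbd.
- move=> n e x _; apply: precell_ext => [j h e'|] /=.
    by rewrite (face_low _ _ h).
  by rewrite face_top.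
- move=> n i h x y _ _ _; apply: precell_ext => [j hj e|] /=.
    by rewrite hj.
  by rewrite ltnn eqxx.
- move=> n i h x y _ _ /= E; apply: precell_ext => [j hj e|] /=.
    rewrite hj; have [+ _] := composable_face E => /(_ j (ltnW (ltn_trans hj h)) e hj).
    by rewrite !(face_low _ _ (ltn_trans hj h)).
  by rewrite ltnn eqxx.
- move=> n j i hj hi h e x y _ _ _; apply: precell_ext => [k hk e'|] //=.
  by rewrite ltnNge (ltnW hi) /= gtn_eqF.
- move=> n i h x y w _ _ _ _ _; apply: precell_face_ext => j hj e.
  rewrite !face_pcomp; case: ltngtP => // _; first by rewrite opA.
- move=> i k h x _; apply: precell_face_ext => j hj e.
  rewrite face_pcomp; case: ltngtP => ji.
  + rewrite (@face_oidn_le _ k.+1 _ _ hj (ltnW ji)).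
    exact: face_pbd_lt.
  + by rewrite (@face_oidn_gt _ k.+1 _ _ hj) ?op0.
  + subst j; case: e => //; rewrite (@face_oidn_le _ k.+1 _ _ hj (leqnn i)).
    exact: face_pbd_eq.
- move=> i k h x _; apply: precell_face_ext => j hj e.
  rewrite face_pcomp; case: ltngtP => ji //.
    by rewrite (@face_oidn_gt _ k.+1 _ _ hj) ?op0r.
  subst j; case: e => //; rewrite (@face_oidn_le _ k.+1 _ _ hj (leqnn i)).
  exact: face_pbd_eq.
- move=> n j i hj hi x x' y y' ij _ _ _ _ _ _ _ _; apply: precell_face_ext => k hk e.
  rewrite !face_pcomp; case: (ltngtP k i) => ki.
  + by rewrite (ltn_trans ki ij).
  + case: (ltngtP k j) => kj //; last by case: e.
    by rewrite opACA.
  + by subst k; rewrite ij; case: e.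
- move=> n i h h' x y _ _ _; apply: precell_face_ext => j hj e.
  rewrite face_pcomp; case: (leq_cases hj) => [h''|E].
    by rewrite !(face_pid_le _ _ _ (h'' : j <= n)) face_pcomp.
  by subst j; rewrite !face_pid_top ltnNge (ltnW h') /= gtn_eqF // op0.
Qed.

End PrecellCategory.
End Precells.

(** * Cells of an augmented directed complex are closed under the operations *)

Section AdcCells.
Variable K : adc.
Local Open Scope ring_scope.

Lemma cellK_pbd n i (h : (i < n)%N) e (X : precell (fun i => K i) n) :
  is_cellK X -> is_cellK (pbd h e X).
Proof.
case=> Xp Xd Xe; split=> [j hj e'|j hj e'|e'].
- case: (leq_cases hj) => [ji|E]; first by rewrite (face_low _ _ ji) /= low_face.
  by subst j; rewrite face_top /= low_face.
- pose hjn := ltn_trans hj h.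
  (* In dimension [j.+1] the boundary has the face of [X] of sign [e'] if [j.+1 < i] and of sign [e]
     if [j.+1 = i]; both have the same differential. *)
  rewrite /= -(Xd j hjn (if (j.+1 < i)%N then e' else e)).
  case: (leq_cases hj) => [ji|E].
    by rewrite ji (face_pbd_lt _ _ _ _ hjn).
  by subst i; rewrite ltnn (face_pbd_eq _ _ _ _ hjn).
- case: i h => [|i] h; first by rewrite (face_pbd_eq _ _ _ _ (leq0n n)).
  by rewrite (face_pbd_lt _ _ _ _ (leq0n n)).
Qed.

Lemma cellK_pid n (X : precell (fun i => K i) n) :
  is_cellK X -> is_cellK (pid (fun n => 0 : K n) X).
Proof.
case=> Xp Xd Xe; split=> [j hj e'|j hj e'|e'].
- case: (leq_cases hj) => [ji|E]; first by rewrite (face_low _ _ ji) /=.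
  by subst j; rewrite face_top; apply: adc_pos0.
- case: (leq_cases hj) => [ji|E].
    rewrite (face_pid_le _ _ _ (ji : (j.+1 <= n)%N)) Xd /=.
    by rewrite !(face_low _ _ (ji : (j < n)%N)).
  by case: E => E; subst j; rewrite face_top /= !face_top raddf0 subrr.
- by rewrite (face_pid_le _ _ _ (leq0n n)).
Qed.

Lemma cellK_pcomp n i (h : (i < n)%N) (X Y : precell (fun i => K i) n) :
  is_cellK X -> is_cellK Y -> pbd h true X = pbd h false Y ->
  is_cellK (Defs.pcomp (fun n (u v : K n) => u + v) h X Y).
Proof.
case=> Xp Xd Xe [Yp Yd Ye] /composable_face [El Ei]; split=> [j hj e'|j hj e'|e'].
- rewrite face_pcomp; case: ifP => // _; case: ifP => // _; first by case: e'.
  exact: adc_posD.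
- rewrite face_pcomp !low_face !face_pcomp.
  case: (ltngtP j i) => ji.
  + have [ji'|ji'|E] := ltngtP j.+1 i; first by rewrite Xd !low_face.
      by move: ji'; rewrite ltnS leqNgt ji.
    (* Here [j.+1 = i]: the target face comes from [Y], whose faces in dimension [j] agree with
       those of [X]. *)
    case: e'; last by rewrite Xd !low_face.
    by rewrite Yd !low_face !El.
  + rewrite ltnNge (leq_trans (ltnW ji)) ?leqnSn //= gtn_eqF ?(ltn_trans ji) //.
    by rewrite raddfD /= Xd Yd !low_face opprD addrACA.
  (* The sum telescopes, because the target of [X] is the source of [Y]. *)
  + subst j; rewrite ltnNge leqnSn /= gtn_eqF // raddfD /= Xd Yd !low_face Ei.
    by rewrite addrC addrA addrNK.
- rewrite face_pcomp; case: ltngtP => // hi; last by case: e'.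
Qed.

Lemma CellK_omega_category : is_omega_category (CellK K).
Proof.
apply: precell_omega_category.
- by move=> n; apply: addrA.
- by move=> n; apply: addrC.
- by move=> n; apply: add0r.
- exact: cellK_pbd.
- exact: cellK_pid.
- exact: cellK_pcomp.
Qed.

End AdcCells.

(** * Coefficients, signed boundaries and atoms *)

Section Basis.
Variables (K : adc) (P : forall n, set (K n)).
Arguments P : clear implicits.
Hypothesis basisP : is_basis P.
Local Open Scope ring_scope.

Lemma zcomb_sub n (c : {fsfun P n -> int with 0}) (S : {fset P n}) :
  (finsupp c `<=` S)%fset -> zcomb c = \sum_(g <- S) val g *~ c g.
Proof.
move=> cS; apply: big_fset_incl => // g _ gc.
by rewrite (fsfun_dflt gc) mulr0z.
Qed.

Lemma coefK n (u : K n) : zcomb (coef P u) = u.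
Proof.
rewrite /coef; case: xgetP => [c -> //|] nc; have [_ [_ _ sj]] := basisP n.
by have [c _ cu] := sj u I; case: (nc c).
Qed.

Lemma zcombK n (c : {fsfun P n -> int with 0}) : coef P (zcomb c) = c.
Proof.
have [_ [_ ij _]] := basisP n.
by apply: ij; rewrite ?inE // coefK.
Qed.

Lemma coefB n (u v : K n) g : coef P (u - v) g = coef P u g - coef P v g.
Proof.
set S := (finsupp (coef P u) `|` finsupp (coef P v))%fset.
pose c : {fsfun P n -> int with 0} :=
  [fsfun h in S => coef P u h - coef P v h | 0].
have -> : u - v = zcomb c.
  have cS : (finsupp c `<=` S)%fset.
    by apply/fsubsetP => h; rewrite mem_finsupp fsfunE; case: ifP; rewrite ?eqxx.
  rewrite (zcomb_sub cS) -{1}(coefK u) -{1}(coefK v).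
  rewrite (zcomb_sub (fsubsetUl _ _ : (_ `<=` S)%fset)).
  rewrite (zcomb_sub (fsubsetUr _ _ : (_ `<=` S)%fset)) -sumrB.
  by apply: eq_big_seq => h hS; rewrite fsfunE hS mulrzBr.
rewrite zcombK fsfunE; case: ifP => // /negbT.
by rewrite inE negb_or => /andP[gu gv]; rewrite !fsfun_dflt ?subrr.
Qed.

(* [coef] as a family of additive maps; the argument [basisP] only serves to
   make additivity available to instance inference. *)
Definition coord (_ : is_basis P) n (g : P n) (u : K n) : int := coef P u g.

HB.instance Definition _ n (g : P n) :=
  GRing.isZmodMorphism.Build (K n) int (coord basisP g)
    (fun u v => coefB u v g).

Lemma coef0 n g : coef P (0 : K n) g = 0.
Proof. exact: (raddf0 (coord basisP g)). Qed.

Lemma coefD n (u v : K n) g : coef P (u + v) g = coef P u g + coef P v g.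
Proof. exact: (raddfD (coord basisP g)). Qed.

Lemma coefMz n (u : K n) (m : int) g : coef P (u *~ m) g = coef P u g *~ m.
Proof. exact: (raddfMz (coord basisP g)). Qed.

Lemma coef_sum n I (r : seq I) (Q : pred I) (F : I -> K n) g :
  coef P (\sum_(i <- r | Q i) F i) g = \sum_(i <- r | Q i) coef P (F i) g.
Proof. exact: (raddf_sum (coord basisP g)). Qed.

Lemma coef_inj n (u v : K n) : (forall g, coef P u g = coef P v g) -> u = v.
Proof. by move=> E; rewrite -(coefK u) -(coefK v); congr zcomb; apply/fsfunP. Qed.

Lemma coef_val n (h g : P n) : coef P (val h) g = (g == h)%:R.
Proof.
pose c : {fsfun P n -> int with 0} := [fsfun x in [fset h]%fset => 1 | 0].
have -> : val h = zcomb c.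
  have cS : (finsupp c `<=` [fset h])%fset.
    by apply/fsubsetP => x; rewrite mem_finsupp fsfunE; case: ifP; rewrite ?eqxx.
  by rewrite (zcomb_sub cS) big_seq_fset1 fsfunE inE eqxx.
by rewrite zcombK fsfunE inE; case: eqP.
Qed.

Lemma sum_coef n (u : K n) :
  u = \sum_(h <- finsupp (coef P u)) val h *~ coef P u h.
Proof. by rewrite -{1}(coefK u). Qed.

Lemma pos_val n (h : P n) : adc_pos (val h).
Proof.
pose c : {fsfun P n -> nat with 0%N} := [fsfun x in [fset h]%fset => 1%N | 0%N].
have -> : val h = ncomb c.
  have cS : (finsupp c `<=` [fset h])%fset.
    by apply/fsubsetP => x; rewrite mem_finsupp fsfunE; case: ifP; rewrite ?eqxx.
  rewrite /ncomb (big_fset_incl _ cS) => [|x _ xc]; last by rewrite (fsfun_dflt xc).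
  by rewrite big_seq_fset1 fsfunE inE eqxx.
by have [[fs _ _] _] := basisP n; apply: fs.
Qed.

Lemma pos_coefP n (u : K n) : adc_pos u <-> forall g, 0 <= coef P u g.
Proof.
split=> [up g|up].
  have [[_ _ sj] _] := basisP n; have [c _ <-] := sj u up.
  rewrite coef_sum sumr_ge0 // => h _.
  by rewrite pmulrn coefMz coef_val -mulrzr mulr_ge0 ?ler0n.
rewrite (sum_coef u) big_seq.
apply: big_ind => [||h _]; [exact: adc_pos0|exact: adc_posD|].
have [m ->] : exists m : nat, coef P u h = m%:Z.
  by exists `|coef P u h|%N; rewrite gez0_abs.
rewrite -pmulrn; elim: m => [|m IH]; first by rewrite mulr0n; apply: adc_pos0.
by rewrite mulrS; apply: adc_posD => //; apply: pos_val.
Qed.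

Lemma kmeet_eq0 n (u v : K n) :
  kmeet P u v = 0 <-> forall g, Num.min (coef P u g) (coef P v g) = 0.
Proof.
have cm g : coef P (kmeet P u v) g = Num.min (coef P u g) (coef P v g).
  rewrite /kmeet; set S := (_ `|` _)%fset.
  pose c : {fsfun P n -> int with 0} :=
    [fsfun h in S => Num.min (coef P u h) (coef P v h) | 0].
  have cS : (finsupp c `<=` S)%fset.
    by apply/fsubsetP => x; rewrite mem_finsupp fsfunE; case: ifP; rewrite ?eqxx.
  rewrite (eq_big_seq (fun h => val h *~ c h)) => [|h hS]; last by rewrite fsfunE hS.
  rewrite -(zcomb_sub cS) zcombK fsfunE; case: ifP => // /negbT.
  by rewrite inE negb_or => /andP[gu gv]; rewrite !fsfun_dflt ?minxx.
split=> [E g|E]; first by rewrite -cm E coef0.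
by apply: coef_inj => g; rewrite cm coef0.
Qed.

Lemma coef_zcomb_on n (S : {fset P n}) (f : P n -> int) g :
  (forall h, h \notin S -> f h = 0) ->
  coef P (\sum_(h <- S) val h *~ f h) g = f g.
Proof.
move=> fS; pose c : {fsfun P n -> int with 0} := [fsfun h in S => f h | 0].
have cS : (finsupp c `<=` S)%fset.
  by apply/fsubsetP => x; rewrite mem_finsupp fsfunE; case: ifP; rewrite ?eqxx.
rewrite (eq_big_seq (fun h => val h *~ c h)) => [|h hS]; last by rewrite fsfunE hS.
rewrite -(zcomb_sub cS) zcombK fsfunE.
by case: ifP => // /negbT/fS.
Qed.

Lemma dpairP n (u : K n.+1) :
  [/\ adc_pos (dpair P u).1, adc_pos (dpair P u).2,
      adc_d K n u = (dpair P u).2 - (dpair P u).1 &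
      kmeet P (dpair P u).1 (dpair P u).2 = 0].
Proof.
(* [xget] returns its default only if no pair qualifies; the negative and positive parts of the
   boundary do qualify. *)
rewrite /dpair; case: xgetP => [p _ //|np]; exfalso.
set du := adc_d K n u.
pose part s := \sum_(h <- finsupp (coef P du)) val h *~ Num.max (s * coef P du h) 0.
have cp s g : coef P (part s) g = Num.max (s * coef P du g) 0.
  by rewrite coef_zcomb_on // => h hn; rewrite (fsfun_dflt hn) mulr0 maxxx.
apply: (np (part (-1), part 1)); split=> /=.
- by apply/pos_coefP => g; rewrite cp le_max lexx orbT.
- by apply/pos_coefP => g; rewrite cp le_max lexx orbT.
- apply: coef_inj => g; rewrite coefB !cp mul1r mulN1r.
  case: (lerP 0 (coef P du g)) => h; first by rewrite max_r ?oppr_le0 ?subr0.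
  by rewrite max_l ?oppr_ge0 ?(ltW h) // opprK add0r.
- apply/kmeet_eq0 => g; rewrite !cp mul1r mulN1r.
  case: (lerP 0 (coef P du g)) => h; first by rewrite max_r ?oppr_le0 // min_l.
  by rewrite min_r // le_max lexx orbT.
Qed.

Lemma dsign_pos e n (u : K n.+1) : adc_pos (dsign P e u).
Proof. by case: e; case: (dpairP u). Qed.

Lemma dsign_ge0 e n (u : K n.+1) g : 0 <= coef P (dsign P e u) g.
Proof. by have /pos_coefP := dsign_pos e u; apply. Qed.

Lemma dsignB n (u : K n.+1) : adc_d K n u = dsign P true u - dsign P false u.
Proof. by case: (dpairP u). Qed.

(** Two nonnegative integers with minimum 0 are the positive and negative parts of their difference;
    hence [d^-] and [d^+] depend on the boundary alone. *)
Lemma coef_dsign e n (u : K n.+1) g :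
  coef P (dsign P e u) g = Num.max (if e then coef P (adc_d K n u) g
                                    else - coef P (adc_d K n u) g) 0.
Proof.
have := dsignB u; case: (dpairP u) => _ _ _ /kmeet_eq0/(_ g) + dE.
rewrite dE coefB /dsign (fun_if (fun w => coef P w g)).
move: (dsign_ge0 true u g) (dsign_ge0 false u g); rewrite /dsign.
move: (coef _ _ _) (coef _ _ _) => b a a0 b0.
case: (lerP b a) => h E; subst.
  by rewrite subr0; case: e; [rewrite max_l | rewrite max_r ?oppr_le0].
by case: e; [rewrite sub0r max_r ?oppr_le0 | rewrite sub0r opprK max_l].
Qed.

Lemma eq_dsign e n (u v : K n.+1) :
  adc_d K n u = adc_d K n v -> dsign P e u = dsign P e v.
Proof. by move=> E; apply: coef_inj => g; rewrite !coef_dsign E. Qed.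

Lemma dsign0 e n : dsign P e (0 : K n.+1) = 0.
Proof. by apply: coef_inj => g; rewrite coef_dsign raddf0 coef0 oppr0 if_same maxxx. Qed.

(** * Atoms are cells *)

Lemma face_atomS n (x : K n.+1) i (h : (i <= n)%N) (h' : (i <= n.+1)%N) e :
  face (atom P x) h' e = face (atom P (dsign P e x)) h e.
Proof. by rewrite (face_low _ _ (h : (i < n.+1)%N)). Qed.

Lemma top_atom n (x : K n) : top (atom P x) = x.
Proof. exact: (face_descent _ _).1. Qed.

Lemma low_atom n (x : K n) i (h : (i < n)%N) e :
  low (atom P x) h e = dsign P e (face (atom P x) h e).
Proof. exact: (face_descent _ _).2. Qed.

Lemma low_atom_eq n (x y : K n.+1) :
  adc_d K n x = adc_d K n y ->
  forall i (h : (i < n.+1)%N) e, low (atom P x) h e = low (atom P y) h e.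
Proof. by move=> E i h e; rewrite /= (eq_dsign _ E). Qed.

Lemma face_atom0 n i (h : (i <= n)%N) e : face (atom P (0 : K n)) h e = 0.
Proof.
elim: n h => [|n IH] h; case: (leq_cases h) => [h'|E] //.
- by subst i; rewrite face_top.
- by rewrite (face_atomS _ (h' : (i <= n)%N)) dsign0.
- by subst i; rewrite face_top.
Qed.

Lemma atom_pos n (x : K n) i (h : (i <= n)%N) e :
  adc_pos x -> adc_pos (face (atom P x) h e).
Proof.
move=> px; case: (leq_cases h) => [h'|E]; last by subst i; rewrite face_top top_atom.
by rewrite (face_low _ _ h') low_atom; apply: dsign_pos.
Qed.

(** The elements [d^- x] and [d^+ x] have equal differentials, because their difference is a
    boundary; so their atoms agree below the top, and one may replace the other in the induction. *)
Lemma atom_bd n (x : K n) i (h : (i < n)%N) e :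
  adc_d K i (face (atom P x) h e) = low (atom P x) h true - low (atom P x) h false.
Proof.
elim: n x h => [//|n IH] x h.
case: (leq_cases h) => [h'|E]; last first.
  by case: E => E; subst i; rewrite !low_atom !face_top top_atom dsignB.
have h2 : (i.+1 <= n)%N := h'.
rewrite (face_atomS _ h2) IH.
have E e' : low (atom P x) h e' = low (atom P (dsign P e' x)) h2 e'.
  by rewrite low_face (face_atomS _ (ltnW h2)) low_face.
rewrite !E; case: n x h h' h2 {IH E} => [//|n] x h h' h2.
have dE e1 e2 : adc_d K n (dsign P e1 x) = adc_d K n (dsign P e2 x).
  have : adc_d K n (dsign P true x) = adc_d K n (dsign P false x).
    by apply/eqP; rewrite -subr_eq0 -raddfB -dsignB adc_dd.
  by case: e1; case: e2.
by congr (_ - _); apply: low_atom_eq.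
Qed.

Hypothesis unitalP : unital P.

Lemma atom_cell n (x : P n) : is_cellK (atom P (val x)).
Proof.
split=> [i h e|i h e|e]; [exact/atom_pos/pos_val|exact: atom_bd|exact: unitalP].
Qed.

(** If a signed boundary vanished, so would all lower faces of that sign, down to dimension 0, where
    unitality gives augmentation 1. *)
Lemma dsign_neq0 e n (x : P n.+1) : dsign P e (val x) <> 0.
Proof.
move=> E; have := unitalP x e.
by rewrite (face_atomS _ (leq0n n)) E face_atom0 raddf0.
Qed.

Lemma dsign_coef_gt0 e n (x : P n.+1) : exists g, 0 < coef P (dsign P e (val x)) g.
Proof.
apply: contrapT => /forallNP H; apply: (@dsign_neq0 e _ x); apply: coef_inj => g.
rewrite coef0; apply/eqP; rewrite eq_le dsign_ge0 andbT leNgt; exact/negP/H.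
Qed.

End Basis.

(** * Multiplicity-freeness of cells *)

(** Adding a boundary to the top changes neither its differential nor, in dimension 0, its
    augmentation. *)
Lemma cellK_retop (K : adc) n (X : precell (fun i => K i) n) (w : K n) (y : K n.+1) :
  is_cellK X -> adc_pos w -> w = (top X + adc_d K n y)%R ->
  is_cellK (Precell (fun i (h : (i < n)%N) e => low X h e) w).
Proof.
move=> [Xp Xd Xe] pw wE; set Y := Precell _ _.
have YE i (h : (i <= n)%N) e : (i < n)%N -> face Y h e = face X h e.
  by move=> h'; rewrite !(face_low _ _ h').
split=> [i h e|i h e|e].
- case: (leq_cases h) => [h'|E]; first by rewrite YE.
  by subst i; rewrite face_top.
- rewrite -(Xd i h e); case: (leq_cases h) => [h'|E]; first by rewrite YE.
  by subst n; rewrite !face_top /= wE raddfD /= adc_dd addr0.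
- rewrite -(Xe e); case: n X w y Xp Xd Xe pw wE @Y YE => [|n] X w y Xp Xd Xe pw wE Y YE.
    by rewrite !face_top /= wE raddfD /= adc_ed addr0.
  by rewrite YE.
Qed.

Section LoopFree.
Variables (K : adc) (P : forall n, set (K n)).
Arguments P : clear implicits.
Hypotheses (basisP : is_basis P) (unitalP : unital P) (loop_freeP : loop_free P).
Local Open Scope ring_scope.

Definition before n (u v : P n.+1) : Prop :=
  @prec K P n (existT (fun n => P n) n.+1 u) (existT (fun n => P n) n.+1 v).

Lemma before_irrefl n (u : P n.+1) : ~ before u u.
Proof. exact: loop_freeP. Qed.

Lemma before_trans n (u v w : P n.+1) : before u v -> before v w -> before u w.
Proof. exact: t_trans. Qed.

(** The [n]-dimensional faces of an atom of dimension [n.+1] are its signed boundaries, so a common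
    [g] is an overlap of the kind that generates [prec n]. *)
Lemma before_step n (u v : P n.+1) g :
  0 < coef P (dsign P true (val u)) g -> 0 < coef P (dsign P false (val v)) g ->
  before u v.
Proof.
move=> ug vg; apply: t_step; exists (ltnSn n), (ltnSn n) => /=.
rewrite !face_top !top_atom => /(kmeet_eq0 basisP)/(_ g)/eqP.
by apply/negP; rewrite gt_eqF // lt_min ug.
Qed.

(** With [x] read as a multiset of transitions, this counts the copies of [g] produced ([e = true])
    or consumed ([e = false]) by those in [D]. *)
Definition flow e n (x : K n.+1) (D : pred (P n.+1)) (g : P n) : int :=
  \sum_(h <- finsupp (coef P x) | D h) coef P x h * coef P (dsign P e (val h)) g.

Lemma flowID e n (x : K n.+1) (D : pred (P n.+1)) g :
  flow e x predT g = flow e x D g + flow e x (predC D) g.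
Proof. by rewrite /flow (bigID D). Qed.

Lemma flow_ge0 e n (x : K n.+1) D g : adc_pos x -> 0 <= flow e x D g.
Proof.
move=> /(pos_coefP basisP) px; apply: sumr_ge0 => h _.
by rewrite mulr_ge0 // dsign_ge0.
Qed.

Lemma flow_eq0 e n (x : K n.+1) (D : pred (P n.+1)) g :
  (forall h, D h -> ~ 0 < coef P (dsign P e (val h)) g) -> flow e x D g = 0.
Proof.
move=> H; apply: big1 => h /H/negP; rewrite -leNgt => le0.
suff -> : coef P (dsign P e (val h)) g = 0 by rewrite mulr0.
by apply/eqP; rewrite eq_le le0 dsign_ge0.
Qed.

Lemma flow_all e n (x : K n.+1) (D : pred (P n.+1)) g :
  (forall h, 0 < coef P (dsign P e (val h)) g -> D h) ->
  flow e x D g = flow e x predT g.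
Proof.
move=> H; rewrite (flowID _ _ D) [X in _ + X]flow_eq0 ?addr0 // => h /= + hg.
by rewrite H.
Qed.

Definition restrict n (x : K n.+1) (D : pred (P n.+1)) : K n.+1 :=
  \sum_(h <- finsupp (coef P x) | D h) val h *~ coef P x h.

Lemma coef_d_restrict n (x : K n.+1) D g :
  coef P (adc_d K n (restrict x D)) g = flow true x D g - flow false x D g.
Proof.
rewrite raddf_sum (coef_sum basisP) -sumrB; apply: eq_bigr => h _.
by rewrite raddfMz (coefMz basisP) (dsignB basisP) (coefB basisP) -mulrzl intz mulrBr.
Qed.

Lemma restrictT n (x : K n.+1) : restrict x predT = x.
Proof. by rewrite [RHS](sum_coef basisP). Qed.

(* Firing only the generators of x lying in a down-closed set D still leads
   from U to a positive element: if g is consumed in D, nothing outside D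
   produces g, and one computes backwards from V instead of forwards from U. *)
Lemma restrict_pos n (x : K n.+1) (U V : K n) (D : pred (P n.+1)) :
  adc_pos x -> adc_pos U -> adc_pos V -> adc_d K n x = V - U ->
  (forall h h', before h h' -> D h' -> D h) ->
  adc_pos (U + adc_d K n (restrict x D)).
Proof.
move=> px /(pos_coefP basisP) pU /(pos_coefP basisP) pV dx down.
apply/(pos_coefP basisP) => g; rewrite (coefD basisP) coef_d_restrict.
have [[h Dh hg]|no] := pselect (exists2 h, D h & 0 < coef P (dsign P false (val h)) g).
  have out0 : flow true x (predC D) g = 0.
    apply: flow_eq0 => h' /= /negP D' h'g; apply: D'.
    exact: down (before_step h'g hg) Dh.
  have := coef_d_restrict x predT g.
  rewrite restrictT dx (coefB basisP) !(flowID _ _ D) out0 addr0 => /eqP.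
  rewrite subr_eq addrC => /eqP E.
  have -> : coef P U g + (flow true x D g - flow false x D g) =
            coef P V g + flow false x (predC D) g.
    by rewrite E opprD !addrA addrNK.
  by rewrite addr_ge0 ?flow_ge0.
rewrite (@flow_eq0 false) => [|h Dh hg]; last by apply: no; exists h.
by rewrite subr0 addr_ge0 ?flow_ge0.
Qed.

Let cell_le1 n := forall (X : precell (fun i => K i) n),
  is_cellK X -> forall g, coef P (top X) g <= 1.

(** The source of [X], with its top [U] replaced by [U + d(restrict x D)], is a cell by
    [restrict_pos] and [cellK_retop]; the bound is the induction hypothesis for this cell. *)
Lemma restrict_le1 n (X : precell (fun i => K i) n.+1) (D : pred (P n.+1)) g :
  cell_le1 n -> is_cellK X ->
  (forall h h', before h h' -> D h' -> D h) ->
  coef P (low X (ltnSn n) false) g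
    + (flow true (top X) D g - flow false (top X) D g) <= 1.
Proof.
move=> le1 cX down; have [Xp Xd _] := cX.
have pl e : adc_pos (low X (ltnSn n) e) by rewrite low_face.
have dX : adc_d K n (top X) = low X (ltnSn n) true - low X (ltnSn n) false.
  by have := Xd n (ltnSn n) true; rewrite face_top.
have pX : adc_pos (top X) by rewrite -(face_top X (leqnn _) true).
have pW := restrict_pos pX (pl false) (pl true) dX down.
have := le1 _ (cellK_retop (cellK_pbd (ltnSn n) false cX) pW erefl) g.
by rewrite /= (coefD basisP) coef_d_restrict.
Qed.

(* The generators preceding every consumer of g form a down-closed set which
   contains all producers of g and, by irreflexivity, no consumer of g. *)
Lemma cell_S_le1 n (X : precell (fun i => K i) n.+1) g :
  cell_le1 n -> is_cellK X ->
  coef P (low X (ltnSn n) false) g + flow true (top X) predT g <= 1 /\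
  coef P (low X (ltnSn n) true) g + flow false (top X) predT g <= 1.
Proof.
move=> le1 cX; have [_ Xd _] := cX.
have le : coef P (low X (ltnSn n) false) g + flow true (top X) predT g <= 1.
  pose D h := `[< forall b : P n.+1,
    0 < coef P (dsign P false (val b)) g -> before h b >].
  have down h h' : before h h' -> D h' -> D h.
    move=> hh' /asboolP Dh'; apply/asboolP => b bg.
    exact: before_trans hh' (Dh' b bg).
  have prod h : 0 < coef P (dsign P true (val h)) g -> D h.
    by move=> hg; apply/asboolP => b bg; apply: before_step hg bg.
  have cons h : D h -> ~ 0 < coef P (dsign P false (val h)) g.
    by move=> /asboolP Dh hg; apply: before_irrefl (Dh h hg).
  have := restrict_le1 g le1 cX down.
  by rewrite (flow_all _ prod) (flow_eq0 _ cons) subr0.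
(* By [d x = V - U] at [g], the two sums are equal. *)
split=> //; have dX := Xd n (ltnSn n) true.
have := coef_d_restrict (top X) predT g.
rewrite face_top in dX; rewrite restrictT dX (coefB basisP) => /eqP.
rewrite subr_eq addrAC addrC => /eqP ->.
by rewrite addrAC addNr add0r addrC.
Qed.

(** In dimension 0 the nonnegative coefficients add up to the augmentation 1; above, the bound on
    what a cell produces limits how often a generator occurs. *)
Lemma cellK_le1 n : cell_le1 n.
Proof.
elim: n => [|n IH] X cX g.
  have [Xp _ Xe] := cX; have := Xe true; rewrite face_top.
  have pX : adc_pos (top X) by rewrite -(face_top X (leqnn _) true).
  rewrite {1}(sum_coef basisP (top X)) raddf_sum.
  have [gX|] := boolP (g \in finsupp (coef P (top X))); last by move/fsfun_dflt ->.
  rewrite (big_fsetD1 g) //= => <-; rewrite raddfMz.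
  (* A generator of dimension 0 is its own 0-dimensional face, so unitality applies to it. *)
  have e1 (h : P 0%N) : adc_e K (val h) = 1.
    by have := unitalP h true; rewrite face_top.
  rewrite e1 intz lerDl; apply: sumr_ge0 => h _.
  by rewrite raddfMz e1 intz; move: h; apply/(pos_coefP basisP).
have pX : adc_pos (top X).
  by case: cX => Xp _ _; rewrite -(face_top X (leqnn _) true).
have [Up|] := boolP (g \in finsupp (coef P (top X))); last by move/fsfun_dflt ->.
(* Each copy of [g] in the top produces at least one copy of [k], so bounding the production of [k]
   bounds the coefficient of [g]. *)
have [k kg] := dsign_coef_gt0 basisP unitalP true g.
have [+ _] := cell_S_le1 k IH cX; rewrite /flow (big_fsetD1 g) //=.
have c0 := (pos_coefP basisP _).1 pX.
have r0 : 0 <= \sum_(h <- (finsupp (coef P (top X)) `\ g)%fset)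
   coef P (top X) h * coef P (dsign P true (val h)) k.
  by apply: sumr_ge0 => h _; rewrite mulr_ge0 // dsign_ge0.
have l0 : 0 <= coef P (low X (ltnSn n) false) k.
  by have [Xp _ _] := cX; move: k {kg r0}; apply/(pos_coefP basisP); rewrite low_face.
apply: le_trans.
apply: le_trans (_ : coef P (top X) g * coef P (dsign P true (val g)) k <= _).
  by rewrite ler_peMr // -gtz0_ge1.
by rewrite addrCA lerDl addr_ge0.
Qed.

End LoopFree.

(** * Sums and supports *)

Section MoveCounting.
Variable Q : hypergraph.
Local Open Scope ring_scope.

(** At most one generator of a fork-free set has [g] in its face of sign [e], so the sum is an
    indicator. *)
Lemma fork_free_sum e n (U : {fset Q n.+1}) g : fork_free U ->
  \sum_(h <- U) (g \in hg_face e h)%:R = (g \in fface e U)%:R :> int.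
Proof.
move=> fU; have [/bigfcupP[h /andP[hU _] gh]|gU] := boolP (g \in fface e U).
  rewrite (big_fsetD1 h) //= gh big_seq big1 ?addr0 // => k.
  rewrite !inE => /andP[/eqP kh kU]; have := fU e k h kU hU kh.
  by move/fsetP/(_ g); rewrite !inE gh andbT => ->.
rewrite big_seq big1 // => h hU; case gh: (g \in _) => //.
by case/negP: gU; apply/bigfcupP; exists h; rewrite ?hU.
Qed.

(** Two distinct generators sharing [g] would already contribute 2. *)
Lemma sum_fork_free n (U : {fset Q n.+1}) :
  (forall e g, \sum_(h <- U) (g \in hg_face e h)%:R <= 1 :> int) -> fork_free U.
Proof.
move=> le1 e u v uU vU uv; apply/fsetP => g; rewrite !inE; apply/negP => /andP[gu gv].
have := le1 e g; rewrite (big_fsetD1 u) //= (big_fsetD1 v) /=; last first.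
  by rewrite !inE vU andbT; apply/eqP => vu; apply: uv.
by rewrite gu gv gerDl; apply/negP; rewrite -ltNge ltr_pwDl // sumr_ge0.
Qed.

(** For each [g] both sides speak of the same four truth values and are compared by cases; the
    integer form is the one that coefficients provide. *)
Lemma movesP n (M : {fset Q n.+1}) (U V : {fset Q n}) :
  moves M U V <-> forall g,
    [/\ (g \in fface true M)%:R - (g \in fface false M)%:R
           = (g \in V)%:R - (g \in U)%:R :> int,
        (g \in U)%:R + (g \in fface true M)%:R <= 1 :> int &
        (g \in V)%:R + (g \in fface false M)%:R <= 1 :> int].
Proof.
split=> [[/fsetP EU /fsetP EV] g|E].
  by move: (EU g) (EV g); rewrite !inE; do 4! case: (g \in _).
by split; apply/fsetP => g; have [] := E g; rewrite !inE; do 4! case: (g \in _).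
Qed.

End MoveCounting.

Section Comparison.
Variables (K : adc) (P : forall n, set (K n)).
Arguments P : clear implicits.
Hypotheses (basisP : is_basis P) (unitalP : unital P) (loop_freeP : loop_free P).
Local Open Scope ring_scope.
Local Notation H := (hypergraph_of P).

Definition supp n (u : K n) : {fset P n} := finsupp (coef P u).
Definition fsum n (U : {fset P n}) : K n := \sum_(x <- U) val x.

Definition Supp n (Y : precell (fun i => K i) n) : precell (fun i => {fset H i}) n :=
  Precell (fun i (h : (i < n)%N) e => supp (low Y h e)) (supp (top Y)).

Lemma coef_fsum n (U : {fset P n}) g : coef P (fsum U) g = (g \in U)%:R.
Proof.
rewrite (coef_sum basisP); under eq_bigr do rewrite (coef_val basisP).
have [gU|gU] := boolP (g \in U).
  rewrite (big_fsetD1 g) //= eqxx big_seq big1 ?addr0 // => h.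
  by rewrite !inE eq_sym => /andP[/negPf ->].
by rewrite big_seq big1 // => h hU; case: eqP gU => // ->; rewrite hU.
Qed.

Lemma fsum_pos n (U : {fset P n}) : adc_pos (fsum U).
Proof. by apply/(pos_coefP basisP) => g; rewrite coef_fsum ler0n. Qed.

Lemma mem_supp n (u : K n) g : adc_pos u -> (g \in supp u) = (0 < coef P u g).
Proof. by move=> /(pos_coefP basisP) pu; rewrite mem_finsupp lt0r pu andbT. Qed.

Lemma fsumK n (U : {fset P n}) : supp (fsum U) = U.
Proof.
apply/fsetP => g; rewrite mem_supp ?coef_fsum; last exact: fsum_pos.
by case: (g \in U).
Qed.

Lemma coef_supp n (u : K n) g : adc_pos u -> coef P u g <= 1 ->
  coef P u g = (g \in supp u)%:R.
Proof.
move=> pu le1; have u0 := (pos_coefP basisP u).1 pu g; rewrite mem_supp //.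
by move: (coef P u g) u0 le1 => [[|[|m]]|m].
Qed.

Lemma suppK n (u : K n) : adc_pos u -> (forall g, coef P u g <= 1) ->
  fsum (supp u) = u.
Proof.
by move=> pu le1; apply: (coef_inj basisP) => g; rewrite coef_fsum coef_supp.
Qed.

Lemma supp0 n : supp (0 : K n) = fset0.
Proof. by rewrite -(fsumK fset0) /fsum big_seq_fset0. Qed.

(** No cancellation occurs between nonnegative coefficients. *)
Lemma suppD n (u v : K n) : adc_pos u -> adc_pos v ->
  supp (u + v) = (supp u `|` supp v)%fset.
Proof.
move=> pu pv; apply/fsetP => g; rewrite inE !mem_supp //; last exact: adc_posD.
have u0 := (pos_coefP basisP u).1 pu g; have v0 := (pos_coefP basisP v).1 pv g.
by rewrite (coefD basisP) !lt0r paddr_eq0 // u0 v0 addr_ge0 // !andbT negb_and.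
Qed.

(** The element [d^e x] is the top of a boundary of the atom of [x], which is a cell; its
    coefficients are thus at most 1, and the set [x^e] records them fully. *)
Lemma coef_dsign_val e n (x : P n.+1) g :
  coef P (dsign P e (val x)) g = (g \in hg_face (h := H) e x)%:R.
Proof.
have pd := dsign_pos basisP e (val x).
have le1 k : coef P (dsign P e (val x)) k <= 1.
  have := cellK_le1 basisP unitalP loop_freeP
    (cellK_pbd (ltnSn n) e (atom_cell basisP unitalP x)) k.
  by rewrite /= !face_top top_atom.
rewrite coef_supp //; congr (nat_of_bool _)%:R.
(* The set defining [x^e] is a finite support, so [fset_set] does not take its default value. *)
rewrite /= (_ : [set y | _] = [set` supp (dsign P e (val x))])%classic ?set_fsetK //.
apply/seteqP; split => y /=.
  move=> /(_ y); rewrite (coef_val basisP) eqxx => y1.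
  by rewrite mem_supp //; apply: lt_le_trans y1.
rewrite mem_supp // => y0 h; rewrite (coef_val basisP).
by case: eqP => [->|_]; [rewrite -gtz0_ge1 | apply: dsign_ge0].
Qed.

Lemma flow_supp e n (x : K n.+1) g : adc_pos x -> (forall h, coef P x h <= 1) ->
  flow e x predT g = \sum_(h <- supp x) (g \in hg_face (h := H) e h)%:R.
Proof.
move=> px le1; apply: eq_big_seq => h hx.
by rewrite coef_dsign_val coef_supp // hx mul1r.
Qed.

Lemma coef_d_fsum n (U : {fset H n.+1}) g : fork_free U ->
  coef P (adc_d K n (fsum U)) g = (g \in fface true U)%:R - (g \in fface false U)%:R.
Proof.
move=> fU; rewrite raddf_sum (coef_sum basisP) -!fork_free_sum // -sumrB.
by apply: eq_bigr => h _; rewrite (dsignB basisP) (coefB basisP) !coef_dsign_val.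
Qed.

(** The indicator of a set difference is the positive part of the difference of indicators, as in
    the formula of [coef_dsign]. *)
Lemma fsum_fborder e n (U : {fset H n.+1}) : fork_free U ->
  fsum (fborder e U) = dsign P e (fsum U).
Proof.
move=> fU; apply: (coef_inj basisP) => g.
rewrite coef_fsum (coef_dsign basisP) coef_d_fsum // inE.
have B (a b : bool) : (~~ b && a)%:R = Num.max (a%:R - b%:R) 0 :> int.
  by case: a; case: b.
by case: e; rewrite ?opprB; apply: B.
Qed.

Lemma face_Sigma n (X : precell (fun i => {fset H i}) n) i (h : (i <= n)%N) e :
  face (@Sigma K P _ X) h e = fsum (face X h e).
Proof.
case: (leq_cases h) => [h'|E]; first by rewrite !(face_low _ _ h').
by subst i; rewrite !face_top.
Qed.

Lemma face_Supp n (Y : precell (fun i => K i) n) i (h : (i <= n)%N) e :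
  face (Supp Y) h e = supp (face Y h e).
Proof.
case: (leq_cases h) => [h'|E]; first by rewrite !(face_low _ _ h').
by subst i; rewrite !face_top.
Qed.

Lemma SigmaK n (X : precell (fun i => {fset H i}) n) : Supp (@Sigma K P _ X) = X.
Proof. by apply: precell_ext => [j h e|] /=; apply: fsumK. Qed.

Lemma adc_e_fsum (U : {fset P 0%N}) : adc_e K (fsum U) = (#|` U|)%:R.
Proof.
rewrite raddf_sum /= (eq_bigr (fun=> 1)) => [|h _].
  by rewrite big_const_seq count_predT iter_addr_0.
by have := unitalP h true; rewrite face_top.
Qed.

Lemma Sigma_cell n (X : precell (fun i => {fset H i}) n) :
  is_cellP X -> is_cellK (@Sigma K P _ X).
Proof.
move=> [Xm Xf]; split=> [i h e|i h e|e].
- by rewrite face_Sigma; apply: fsum_pos.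
- rewrite face_Sigma; apply: (coef_inj basisP) => g.
  rewrite (coef_d_fsum _ (Xf i.+1 h e)) (coefB basisP) !coef_fsum.
  by have /movesP/(_ g)[-> _ _] := Xm i h e.
- by rewrite face_Sigma adc_e_fsum; have := Xf 0%N (leq0n n) e => /= ->.
Qed.

(** Presents each face as the top of a cell with the same lower faces, so that facts about tops
    apply in every dimension. *)
Lemma cellK_face n (Y : precell (fun i => K i) n) i (h : (i <= n)%N) e :
  is_cellK Y -> exists Z : precell (fun i => K i) i,
    [/\ is_cellK Z, top Z = face Y h e &
        forall j (hj : (j < i)%N) (hj' : (j < n)%N) e', low Z hj e' = low Y hj' e'].
Proof.
move=> cY; case: (leq_cases h) => [h'|E].
  exists (pbd h' e Y); split; [exact: cellK_pbd|by rewrite (face_low _ _ h')|].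
  by move=> j hj hj' e' /=; congr low; apply: bool_irrelevance.
subst i; exists Y; split=> // [|j hj hj' e']; first by rewrite face_top.
by congr low; apply: bool_irrelevance.
Qed.

Lemma cellK_face_le1 n (Y : precell (fun i => K i) n) i (h : (i <= n)%N) e g :
  is_cellK Y -> coef P (face Y h e) g <= 1.
Proof. by move=> /(cellK_face h e)[Z [cZ <- _]]; apply: cellK_le1. Qed.

Lemma cellK_top_pos n (Y : precell (fun i => K i) n) : is_cellK Y -> adc_pos (top Y).
Proof. by case=> Yp _ _; rewrite -(face_top Y (leqnn n) true). Qed.

Lemma coef_low n (Y : precell (fun i => K i) n) i (h : (i < n)%N) e g :
  is_cellK Y -> coef P (low Y h e) g = (g \in supp (low Y h e))%:R.
Proof.
move=> cY; have [Yp _ _] := cY.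
by rewrite low_face; apply: coef_supp; [exact: Yp | exact: cellK_face_le1].
Qed.

(** These are the inequalities of [cell_S_le1] read on supports: production is paired with the
    source and consumption with the target, whence the sign [~~ e]. *)
Lemma cellK_top_sum n (Y : precell (fun i => K i) n.+1) e g : is_cellK Y ->
  (g \in supp (low Y (ltnSn n) (~~ e)))%:R +
  \sum_(h <- supp (top Y)) (g \in hg_face (h := H) e h)%:R <= 1 :> int.
Proof.
move=> cY; have pY := cellK_top_pos cY; have [Yp _ _] := cY.
have le1 := cellK_le1 basisP unitalP loop_freeP.
have [le_true le_false] := cell_S_le1 basisP loop_freeP g (@le1 n) cY.
by rewrite -(flow_supp e g pY (le1 _ _ cY)) -coef_low //; case: e.
Qed.

(** In dimension 0 the augmentation counts the elements of the support; above, dropping the boundary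
    term of [cellK_top_sum] leaves the bound required by [sum_fork_free]. *)
Lemma supp_fork_free n (Y : precell (fun i => K i) n) : is_cellK Y ->
  fork_free (P := H) (supp (top Y)).
Proof.
move=> cY; have pY := cellK_top_pos cY.
case: n Y cY pY => [|n] Y cY pY.
  have [_ _ /(_ true)] := cY; rewrite face_top -[top Y]suppK //; last exact: cellK_le1.
  by rewrite adc_e_fsum fsumK => /eqP; rewrite pnatr_eq1 => /eqP.
apply: sum_fork_free => e g; apply: le_trans (cellK_top_sum e g cY).
by rewrite lerDr ler0n.
Qed.

(** The clauses of [movesP] are the differential equation of the cell and the two signs of
    [cellK_top_sum]. *)
Lemma supp_moves n (Y : precell (fun i => K i) n.+1) : is_cellK Y ->
  moves (P := H) (supp (top Y)) (supp (low Y (ltnSn n) false))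
    (supp (low Y (ltnSn n) true)).
Proof.
move=> cY; have pY := cellK_top_pos cY; have [Yp Yd _] := cY.
have fY := supp_fork_free cY.
have E g : (g \in fface (P := H) true (supp (top Y)))%:R -
    (g \in fface (P := H) false (supp (top Y)))%:R =
    (g \in supp (low Y (ltnSn n) true))%:R -
    (g \in supp (low Y (ltnSn n) false))%:R :> int.
  rewrite -coef_d_fsum // suppK //; last exact: cellK_le1.
  have := Yd n (ltnSn n) true; rewrite face_top => ->; rewrite (coefB basisP).
  by rewrite !coef_low.
have L e g := cellK_top_sum e g cY.
apply/movesP => g; split=> //.
  by rewrite -(fork_free_sum true g fY); apply: (L true g).
by rewrite -(fork_free_sum false g fY); apply: (L false g).
Qed.

Lemma Supp_cell n (Y : precell (fun i => K i) n) : is_cellK Y -> is_cellP (Supp Y).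
Proof.
move=> cY; split=> [i h e|i h e]; rewrite face_Supp;
  have [Z [cZ <- ZY]] := cellK_face h e cY.
  by rewrite /= -!(ZY i (ltnSn i)); apply: supp_moves.
exact: supp_fork_free.
Qed.

Lemma SuppK n (Y : precell (fun i => K i) n) : is_cellK Y -> @Sigma K P _ (Supp Y) = Y.
Proof.
move=> cY; apply: precell_face_ext => i h e; rewrite face_Sigma face_Supp suppK //.
  by case: cY.
by move=> g; apply: cellK_face_le1.
Qed.

(** * Compatibility of sums and supports with the operations *)

Lemma Supp_pid n (Y : precell (fun i => K i) n) :
  Supp (pid (fun n => 0 : K n) Y) = pid (fun n => fset0 : {fset H n}) (Supp Y).
Proof.
apply: precell_ext => [j h e|] /=; last exact: supp0.
by rewrite face_Supp.
Qed.

Lemma Supp_pcomp n i (h : (i < n)%N) (X Y : precell (fun i => K i) n) :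
  is_cellK X -> is_cellK Y ->
  Supp (Defs.pcomp (fun n (u v : K n) => u + v) h X Y) =
  Defs.pcomp (fun n (U V : {fset H n}) => (U `|` V)%fset) h (Supp X) (Supp Y).
Proof.
move=> [Xp _ _] [Yp _ _]; apply: precell_face_ext => j hj e.
rewrite face_Supp !face_pcomp !face_Supp; case: ltngtP => // _; last by case: e.
exact: suppD.
Qed.

Lemma Supp_functor :
  is_omega_functor (C := CellK K) (D := CellP H) (fun n => @Supp n).
Proof.
split=> [n x|n i h e x _|n x _|n i h x y cx cy _].
- exact: Supp_cell.
- exact: precell_ext.
- exact: Supp_pid.
- exact: Supp_pcomp.
Qed.

Lemma Sigma_pbd n i (h : (i < n)%N) e (X : precell (fun i => {fset H i}) n) :
  @Sigma K P _ (pbd h e X) = pbd h e (@Sigma K P _ X).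
Proof. exact: precell_ext. Qed.

Lemma Sigma_pid n (X : precell (fun i => {fset H i}) n) :
  @Sigma K P _ (pid (fun n => fset0 : {fset H n}) X) =
  pid (fun n => 0 : K n) (@Sigma K P _ X).
Proof.
apply: precell_ext => [j h e|] /=; last exact: big_seq_fset0.
by rewrite face_Sigma.
Qed.

Lemma Sigma_composable n i (h : (i < n)%N) (X Y : precell (fun i => {fset H i}) n) :
  pbd h true X = pbd h false Y ->
  pbd h true (@Sigma K P _ X) = pbd h false (@Sigma K P _ Y).
Proof. by move=> E; rewrite -!Sigma_pbd E. Qed.

(* The unions in a composite are disjoint because the coefficients of the
   composite in Cell(K) are at most 1. *)
Lemma Sigma_pcomp n i (h : (i < n)%N) (X Y : precell (fun i => {fset H i}) n) :
  is_cellP X -> is_cellP Y -> pbd h true X = pbd h false Y ->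
  @Sigma K P _ (Defs.pcomp (fun n (U V : {fset H n}) => (U `|` V)%fset) h X Y) =
  Defs.pcomp (fun n (u v : K n) => u + v) h (@Sigma K P _ X) (@Sigma K P _ Y).
Proof.
move=> /Sigma_cell cX /Sigma_cell cY /Sigma_composable E.
by rewrite -{1}(SigmaK X) -{1}(SigmaK Y) -Supp_pcomp // SuppK //; apply: cellK_pcomp.
Qed.

Lemma Sigma_functor :
  is_omega_functor (C := CellP H) (D := CellK K) (fun n => @Sigma K P n).
Proof.
split=> [n x|n i h e x _|n x _|n i h x y].
- exact: Sigma_cell.
- exact: Sigma_pbd.
- exact: Sigma_pid.
- exact: Sigma_pcomp.
Qed.

Lemma CellP_omega_category : is_omega_category (CellP H).
Proof.
apply: precell_omega_category.
- by move=> n; apply: fsetUA.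
- by move=> n; apply: fsetUC.
- by move=> n; apply: fset0U.
(* Closure is inherited: each result is [Supp] of its image under [Sigma], which turns the operation
   into that of the complex. *)
- move=> n i h e X /Sigma_cell cX; rewrite -(SigmaK (pbd _ _ _)) Sigma_pbd.
  exact/Supp_cell/cellK_pbd.
- move=> n X /Sigma_cell cX; rewrite -(SigmaK (pid _ _)) Sigma_pid.
  exact/Supp_cell/cellK_pid.
- move=> n i h X Y cX cY E; rewrite -(SigmaK (Defs.pcomp _ _ _ _)) Sigma_pcomp //.
  apply/Supp_cell/cellK_pcomp; [exact: Sigma_cell|exact: Sigma_cell|].
  exact: Sigma_composable.
Qed.

(** Descending induction on the dimension of the face. Each face of the atom is the top of a cell of
    the complex, so the matching set, being its support, is fork-free and [fsum_fborder] applies. *)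
Lemma Sigma_hatom n (x : P n) : @Sigma K P _ (hatom H x) = atom P (val x).
Proof.
have cx := atom_cell basisP unitalP x.
apply: precell_face_ext => i h e; rewrite face_Sigma.
have [k] := ubnP (n - i)%N; elim: k i h => // k IH i h nk.
case: (leq_cases h) => [h'|E]; last first.
  by subst i; rewrite !face_top top_atom (face_descent _ _).1 /fsum big_seq_fset1.
have ik : (n - i.+1 < k)%N by rewrite -ltnS (leq_ltn_trans _ nk) // ltn_sub2l.
have E := IH i.+1 h' ik.
rewrite !(face_low _ _ h') low_atom (face_descent _ _).2 -E.
apply: fsum_fborder; have [Z [cZ tZ _]] := cellK_face h' e cx.
by rewrite -[face _ _ _]fsumK E -tZ; apply: supp_fork_free.
Qed.

End Comparison.

Theorem mainTheorem11 (K : adc) (P : forall n, set (K n))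
    (basisP : is_basis P) (unitalP : unital P) (loop_freeP : loop_free P) :
  is_omega_isomorphism (CellP (hypergraph_of P)) (CellK K) (Sigma P)
  /\ (forall n (x : P n),
        Sigma P n (hatom (hypergraph_of P) x) = atom P (val x)).
Proof.
split; last by move=> n x; apply: Sigma_hatom.
split; [exact: CellP_omega_category|exact: CellK_omega_category|exact: Sigma_functor|].
exists (fun n => @Supp K P n); split.
- exact: Supp_functor.
- by move=> n x _; apply: SigmaK.
- by move=> n y; apply: SuppK.
Qed.
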